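(* Let $G=(X\cup Y,E)$ be a finite simple connected bipartite graph, not isomorphic to $K_2$, with bipartition classes $X$ and $Y$, such that no automorphism of $G$ interchanges $X$ and $Y$. Then $OD'^-(G)=\lceil D'(G)/2\rceil$ and $OD'^+(G)=D'(G)$.
   Context: Write $[k]=\{1,\ldots,k\}$. For a graph $G$, an edge colouring $c\colon E(G)\to[k]$ (not necessarily proper) breaks an automorphism $\varphi\in\operatorname{Aut}(G)$ if some edge $xy$ satisfies $c(\varphi(x)\varphi(y))\neq c(xy)$; it is distinguishing if it breaks every non-trivial automorphism of $G$. The distinguishing index $D'(G)$ is the least integer $k\ge 1$ for which $G$ has a distinguishing colouring $E(G)\to[k]$. For a digraph, automorphisms preserve arcs together with their directions, and distinguishing arc colourings and the distinguishing index $D'$ are defined in the same way with arcs in place of edges. An orientation of $G$ is a digraph $\overrightarrow{G}$ obtained from $G$ by replacing each edge $xy$ with exactly one of the arcs $\overrightarrow{xy}$, $\overrightarrow{yx}$. Define $OD'^-(G)=\min D'(\overrightarrow{G})$ and $OD'^+(G)=\max D'(\overrightarrow{G})$, both over all orientations $\overrightarrow{G}$ of $G$. *)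

(* Defs.v *)
From mathcomp Require Import all_boot all_fingroup.

Set Implicit Arguments.
Unset Strict Implicit.
Unset Printing Implicit Defensive.

Record sgraph := SGraph {
  vertex :> finType;
  adj : rel vertex;
  adj_sym : symmetric adj;
  adj_irr : irreflexive adj
}.

Fact complete_sym n : symmetric (fun x y : 'I_n => x != y).
Proof. by move=> x y; rewrite eq_sym. Qed.

Fact complete_irr n : irreflexive (fun x y : 'I_n => x != y).
Proof. by move=> x; rewrite eqxx. Qed.

Definition complete_graph n : sgraph :=
  SGraph (@complete_sym n) (@complete_irr n).

Definition isomorphic (G H : sgraph) : Prop :=
  exists2 f : G -> H, bijective f & forall x y, adj (f x) (f y) = adj x y.

Definition connected_graph (G : sgraph) : Prop :=
  forall x y : G, connect (@adj G) x y.

Definition bipartition (G : sgraph) (X Y : {set G}) : Prop :=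
  [/\ X :|: Y = [set: G],
      [disjoint X & Y]
    & forall x y : G, adj x y ->
        (x \in X) && (y \in Y) || (x \in Y) && (y \in X)].

(* A digraph on T is a relation a : rel T (a x y: there is an arc from x to y).
   On the symmetric relation of a graph, is_aut characterizes the graph automorphisms. *)
Definition is_aut (T : finType) (r : rel T) (p : {perm T}) : bool :=
  [forall x, forall y, r (p x) (p y) == r x y].

Definition interchanges (T : finType) (p : {perm T}) (X Y : {set T}) : Prop :=
  p @: X = Y /\ p @: Y = X.

(* The colour set [k] is 'I_k. Edge colourings are functions of the unordered
   pair [set x; y], arc colourings functions of the ordered pair (x, y); their
   values outside the edges (resp. arcs) are never used. *)
Definition breaks_edges (G : sgraph) k (c : {ffun {set G} -> 'I_k})
    (p : {perm G}) : bool :=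
  [exists x, exists y, adj x y && (c [set p x; p y] != c [set x; y])].

Definition distinguishing_edges (G : sgraph) k
    (c : {ffun {set G} -> 'I_k}) : bool :=
  [forall p : {perm G}, is_aut (@adj G) p && (p != 1%g) ==> breaks_edges c p].

Definition breaks_arcs (T : finType) (a : rel T) k
    (c : {ffun T * T -> 'I_k}) (p : {perm T}) : bool :=
  [exists x, exists y, a x y && (c (p x, p y) != c (x, y))].

Definition distinguishing_arcs (T : finType) (a : rel T) k
    (c : {ffun T * T -> 'I_k}) : bool :=
  [forall p : {perm T}, is_aut a p && (p != 1%g) ==> breaks_arcs a c p].

Definition least_pos (P : pred nat) (k : nat) : Prop :=
  [/\ 0 < k, P k & forall j, 0 < j -> P j -> k <= j].

(* is_dist_index G d reads D'(G) = d. It is a relation because D' need not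
   exist for an arbitrary graph (K_2 has no distinguishing colouring). *)
Definition is_dist_index (G : sgraph) (d : nat) : Prop :=
  least_pos (fun k =>
    [exists c : {ffun {set G} -> 'I_k}, distinguishing_edges c]) d.

Definition is_arc_dist_index (T : finType) (a : rel T) (d : nat) : Prop :=
  least_pos (fun k =>
    [exists c : {ffun T * T -> 'I_k}, distinguishing_arcs a c]) d.

Definition orientation (G : sgraph) (a : rel G) : Prop :=
  forall x y : G, (a x y || a y x) = adj x y /\ ~~ (a x y && a y x).

(* Minimum and maximum of D' over all orientations; both include that every
   orientation has a distinguishing index. *)
Definition is_OD_min (G : sgraph) (m : nat) : Prop :=
  (exists2 a : rel G, orientation a & is_arc_dist_index a m) /\
  (forall a : rel G, orientation a ->
     exists2 d, is_arc_dist_index a d & m <= d).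

Definition is_OD_max (G : sgraph) (m : nat) : Prop :=
  (exists2 a : rel G, orientation a & is_arc_dist_index a m) /\
  (forall a : rel G, orientation a ->
     exists2 d, is_arc_dist_index a d & d <= m).

(* Main.v *)
Require Import Defs.
From mathcomp Require Import all_boot all_fingroup zify.

(** Since [G] is connected, an automorphism that moves one vertex to the other
    side of the bipartition moves all of them, hence interchanges the two sides.
    Such automorphisms being excluded, every automorphism maps [X] to itself
    ([aut_preserves_side]), and [X] gives each edge a reference direction, from
    its end in [X] to its end outside, that all automorphisms respect.

    Relative to this direction, an orientation together with an arc colouring is
    the same thing as an assignment of a pair (sign, colour) to each edge, the
    [signed_colour], where the sign says whether the arc follows the reference
    direction. The automorphisms of the orientation that keep the arc colouring
    are exactly the automorphisms of [G] that keep the signed colours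
    ([keeps_signed], [signed_keeps]). Hence a distinguishing colouring may be
    transferred between edges and arcs whenever the given colouring can be
    recovered from the new one ([arcs_of_edges], [edges_of_arcs]).

    Let [d] be the distinguishing index of [G]; it exists because giving all
    edges different colours works ([distinguishing_edges_exist]).
    - Colouring arcs as their edges: a distinguishing colouring then breaks every
      non-trivial automorphism of every
      orientation, so that each of them has index at most [d].
    - Counting signed colours: [k] arc colours give at most [2k] signed colours,
      so [d <= 2k], that is, [uphalf d <= k].
    - The bound [d] is attained by orienting every edge from [X] to its
      complement: all signs agree, so the arc colours alone determine the
      signed colours.
    - The bound [uphalf d] is attained by spending the sign on one bit of the
      edge colour: edges are oriented by the parity of their colour and arcs
      coloured by half of it. *)

Set Implicit Arguments.
Unset Strict Implicit.
Unset Printing Implicit Defensive.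

(** * Distinguishing colourings and their least number of colours *)

Lemma least_pos_exists (P : pred nat) k :
  0 < k -> P k -> exists2 d, least_pos P d & d <= k.
Proof.
move=> k_gt0 Pk; have exP : exists j, (0 < j) && P j by exists k; apply/andP.
case: (ex_minnP exP) => d /andP[d_gt0 Pd] minP.
exists d; last by apply: minP; apply/andP.
by split=> // j j_gt0 Pj; apply: minP; apply/andP.
Qed.

Lemma is_autP (T : finType) (r : rel T) (p : {perm T}) :
  reflect (forall x y, r (p x) (p y) = r x y) (is_aut r p).
Proof.
apply: (iffP forallP) => [H x y | H x]; first by have /forallP/(_ y)/eqP := H x.
by apply/forallP => y; rewrite H.
Qed.

Definition keeps_edges (G : sgraph) k (c : {ffun {set G} -> 'I_k})
    (p : {perm G}) : Prop :=
  forall x y, adj x y -> c [set p x; p y] = c [set x; y].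

Definition keeps_arcs (T : finType) (a : rel T) k (c : {ffun T * T -> 'I_k})
    (p : {perm T}) : Prop :=
  forall x y, a x y -> c (p x, p y) = c (x, y).

Lemma distinguishing_edgesP (G : sgraph) k (c : {ffun {set G} -> 'I_k}) :
  reflect (forall p, is_aut (@adj G) p -> keeps_edges c p -> p = 1%g)
          (distinguishing_edges c).
Proof.
apply: (iffP forallP) => [H p p_aut kept | H p].
  apply/eqP; apply: contraTT (H p) => p_neq1; rewrite p_aut p_neq1 /=.
  apply/existsPn => x; apply/existsPn => y; apply/nandP.
  by case: (boolP (adj x y)) => [/kept->|]; [right; rewrite eqxx | left].
apply/implyP => /andP[p_aut]; apply: contraNT => /existsPn unbroken.
apply/eqP/(H p p_aut) => x y xy.
by have /existsPn/(_ y) := unbroken x; rewrite xy /= negbK => /eqP.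
Qed.

Lemma distinguishing_arcsP (T : finType) (a : rel T) k
    (c : {ffun T * T -> 'I_k}) :
  reflect (forall p, is_aut a p -> keeps_arcs a c p -> p = 1%g)
          (distinguishing_arcs a c).
Proof.
apply: (iffP forallP) => [H p p_aut kept | H p].
  apply/eqP; apply: contraTT (H p) => p_neq1; rewrite p_aut p_neq1 /=.
  apply/existsPn => x; apply/existsPn => y; apply/nandP.
  by case: (boolP (a x y)) => [/kept->|]; [right; rewrite eqxx | left].
apply/implyP => /andP[p_aut]; apply: contraNT => /existsPn unbroken.
apply/eqP/(H p p_aut) => x y xy.
by have /existsPn/(_ y) := unbroken x; rewrite xy /= negbK => /eqP.
Qed.

(** * Automorphisms preserve the sides of the bipartition *)

Lemma bipartition_setC (G : sgraph) (X Y : {set G}) :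
  bipartition X Y -> Y = ~: X.
Proof.
case=> XY_cover XY_disj _; apply/setP => x; rewrite inE.
have := in_setT x; rewrite -XY_cover inE.
by case: (boolP (x \in X)) => [/(disjointFr XY_disj)|].
Qed.

Definition edges_cross (G : sgraph) (X : {set G}) : Prop :=
  forall x y : G, adj x y -> (y \in X) = (x \notin X).

Lemma bipartition_cross (G : sgraph) (X Y : {set G}) :
  bipartition X Y -> edges_cross X.
Proof.
move=> bXY x y xy; have [_ _ /(_ x y xy)] := bXY.
by rewrite (bipartition_setC bXY) !inE; do 2!case: (_ \in X).
Qed.

Lemma connected_ind (G : sgraph) (P : pred G) (x y : G) :
  connected_graph G -> (forall u v, adj u v -> P u -> P v) -> P x -> P y.
Proof.
move=> G_conn adjP; case/connectP: (G_conn x y) => s + ->.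
by elim: s x => //= z s IHs x /andP[xz /IHs] Ps /(adjP _ _ xz).
Qed.

Definition preserves_side (G : sgraph) (X : {set G}) : Prop :=
  forall p : {perm G}, is_aut (@adj G) p -> forall x, (p x \in X) = (x \in X).

(** Two adjacent vertices lie on different sides, and so do their images; hence
    crossing to the other side propagates from a vertex to its neighbours and,
    by connectedness, to the whole graph. *)
Lemma aut_preserves_side (G : sgraph) (X Y : {set G}) :
    connected_graph G -> bipartition X Y ->
    (forall p : {perm G}, is_aut (@adj G) p -> ~ interchanges p X Y) ->
  preserves_side X.
Proof.
move=> G_conn bXY no_swap p p_aut x; apply/eqP/negPn/negP => x_swap.
case: (no_swap p p_aut); have crossX := bipartition_cross bXY.
have swap z : (p z \in X) = (z \notin X).
  have : (p z \in X) != (z \in X).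
    apply: (connected_ind (P := fun z => (p z \in X) != (z \in X))) x_swap => //.
    move=> u v uv; have puv : adj (p u) (p v) by rewrite (is_autP _ _ p_aut).
    rewrite (crossX _ _ uv) (crossX _ _ puv).
    by do 2!case: (_ \in X).
  by do 2!case: (_ \in X).
have im_swap (A : {set G}) :
    (forall z, (p z \in ~: A) = (z \in A)) -> p @: A = ~: A.
  move=> pA; apply/setP => z; rewrite -[z](permKV p) mem_imset ?pA //.
  exact: perm_inj.
rewrite (bipartition_setC bXY); split; last rewrite -[RHS]setCK.
  by apply: im_swap => z; rewrite !inE swap negbK.
by apply: im_swap => z; rewrite setCK inE swap.
Qed.

(** * Orientations as signs on the edges *)

(** Meant for [x] in [X] and [y] a neighbour of [x]: the sign of the edge [xy]
    is its direction relative to [X]. *)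
Definition signed_colour (T : finType) (a : rel T) k
    (c : {ffun T * T -> 'I_k}) (x y : T) : bool * 'I_k :=
  (a x y, if a x y then c (x, y) else c (y, x)).

Lemma orientation_sub (G : sgraph) (a : rel G) x y :
  orientation a -> a x y -> adj x y.
Proof. by move=> a_or xy; have [<- _] := a_or x y; rewrite xy. Qed.

Lemma orientation_rev (G : sgraph) (a : rel G) x y :
  orientation a -> adj x y -> a y x = ~~ a x y.
Proof. by move=> /(_ x y)[<-]; do 2!case: (a _ _). Qed.

Lemma orientation_aut (G : sgraph) (a : rel G) p :
  orientation a -> is_aut a p -> is_aut (@adj G) p.
Proof.
move=> a_or /is_autP p_aut; apply/is_autP => x y.
by have [<- _] := a_or x y; have [<- _] := a_or (p x) (p y); rewrite !p_aut.
Qed.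

Lemma keeps_edges_side (G : sgraph) (X : {set G}) k
    (c : {ffun {set G} -> 'I_k}) (p : {perm G}) :
    edges_cross X ->
    (forall x y, x \in X -> adj x y -> c [set p x; p y] = c [set x; y]) ->
  keeps_edges c p.
Proof.
move=> bX kept x y xy; have [xX|xX] := boolP (x \in X); first exact: kept.
rewrite (setUC [set p x]) (setUC [set x]); apply: kept.
  by rewrite (bX x y).
by rewrite adj_sym.
Qed.

Lemma keeps_signed (G : sgraph) (a : rel G) k (c : {ffun G * G -> 'I_k})
    (p : {perm G}) x y :
    orientation a -> is_aut a p -> keeps_arcs a c p -> adj x y ->
  signed_colour a c (p x) (p y) = signed_colour a c x y.
Proof.
move=> a_or /is_autP p_aut kept xy; rewrite /signed_colour p_aut.
case: ifP => axy; first by rewrite kept.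
by rewrite kept // (orientation_rev a_or xy) axy.
Qed.

(** The converse of [keeps_signed]. Equality of signed colours read from [X] is
    enough because reading an edge from its other end negates its sign. *)
Lemma signed_keeps (G : sgraph) (X : {set G}) (a : rel G) k
    (c : {ffun G * G -> 'I_k}) (p : {perm G}) :
    edges_cross X -> orientation a -> is_aut (@adj G) p ->
    (forall x y, x \in X -> adj x y ->
       signed_colour a c (p x) (p y) = signed_colour a c x y) ->
  is_aut a p /\ keeps_arcs a c p.
Proof.
move=> bX a_or /is_autP p_aut kept.
have rev := orientation_rev a_or.
have adj_case x y : adj x y ->
    a (p x) (p y) = a x y /\ (a x y -> c (p x, p y) = c (x, y)).
  move=> xy; have [xX|xX] := boolP (x \in X).
    by have [-> +] := kept x y xX xy; case: (a x y) => // ->.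
  have yx : adj y x by rewrite adj_sym.
  have yX : y \in X by rewrite (bX x y).
  have pyx : adj (p y) (p x) by rewrite p_aut.
  have [sgn +] := kept y x yX yx.
  by rewrite (rev _ _ yx) (rev _ _ pyx) sgn; case: (a y x) => // ->.
split; last by move=> x y /[dup] /(orientation_sub a_or) /adj_case[].
apply/is_autP => x y; have [/adj_case[]//|xy] := boolP (adj x y).
rewrite (contraNF (orientation_sub a_or) xy).
by apply: contraNF xy => /(orientation_sub a_or); rewrite p_aut.
Qed.

(** * Transfer between edge colourings and arc colourings *)

(** If the signed colour of an edge determines its colour, whatever keeps the
    oriented arc colouring keeps the edge colouring, and so is trivial. *)
Lemma arcs_of_edges (G : sgraph) (X : {set G}) (a : rel G) k m
    (c : {ffun {set G} -> 'I_m}) (c' : {ffun G * G -> 'I_k}) :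
    edges_cross X -> preserves_side X -> orientation a ->
    (forall x y u v, x \in X -> u \in X -> adj x y -> adj u v ->
       signed_colour a c' x y = signed_colour a c' u v ->
       c [set x; y] = c [set u; v]) ->
  distinguishing_edges c -> distinguishing_arcs a c'.
Proof.
move=> bX sideX a_or det /distinguishing_edgesP dc.
apply/distinguishing_arcsP => p p_aut kept.
have Gp := orientation_aut a_or p_aut; apply: (dc p Gp).
apply: (keeps_edges_side bX) => x y xX xy.
by apply: det; rewrite ?sideX ?(is_autP _ _ Gp) // keeps_signed.
Qed.

(** The map [g] encodes signed colours as edge colours. It has to be injective
    on the signed colours that occur: for an orientation with a single sign,
    forgetting the sign is then an admissible encoding. *)
Lemma edges_of_arcs (G : sgraph) (X : {set G}) (a : rel G) k m
    (c : {ffun G * G -> 'I_k}) (g : bool * 'I_k -> 'I_m.+1) :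
    edges_cross X -> preserves_side X -> orientation a ->
    (forall x y u v, x \in X -> u \in X -> adj x y -> adj u v ->
       g (signed_colour a c x y) = g (signed_colour a c u v) ->
       signed_colour a c x y = signed_colour a c u v) ->
    distinguishing_arcs a c ->
  [exists c' : {ffun {set G} -> 'I_m.+1}, distinguishing_edges c'].
Proof.
move=> bX sideX a_or g_inj /distinguishing_arcsP dc.
(* An edge is an unordered pair; its unique enumeration starting in X
   recovers the reference direction. *)
pose X_first (e : {set G}) (u : G * G) :=
  [&& u.1 \in X, u.2 \notin X & e == [set u.1; u.2]].
pose c' : {ffun {set G} -> 'I_m.+1} := [ffun e : {set G} =>
  if [pick u | X_first e u] is Some u then g (signed_colour a c u.1 u.2)
  else ord0].
have c'E x y : x \in X -> adj x y ->
    c' [set x; y] = g (signed_colour a c x y).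
  move=> xX xy; have yX : y \notin X by rewrite (bX x y) ?xX.
  rewrite ffunE; case: pickP => [[u v] /and3P[/= uX vX /eqP exy]|/(_ (x, y))].
    have := set21 x y; rewrite exy !inE => /orP[/eqP<-|/eqP xv]; last first.
      by rewrite -xv xX in vX.
    have := set22 x y; rewrite exy !inE => /orP[/eqP yu|/eqP<-] //.
    by rewrite yu uX in yX.
  by rewrite /X_first /= xX yX eqxx.
apply/existsP; exists c'; apply/distinguishing_edgesP => p p_aut kept.
have [|p_a p_c] := @signed_keeps G X a k c p bX a_or p_aut; last exact: dc.
move=> x y xX xy; apply: g_inj; rewrite ?sideX ?(is_autP _ _ p_aut) //.
by rewrite -!c'E ?sideX ?(is_autP _ _ p_aut) // kept.
Qed.

(** When all edges have different colours, a colour-keeping automorphism maps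
    each edge to itself, and it cannot swap the ends since these lie on
    different sides. So it fixes every vertex that has a neighbour; a vertex
    without neighbours is the whole of a connected graph. *)
Lemma distinguishing_edges_exist (G : sgraph) (X : {set G}) :
    connected_graph G -> edges_cross X -> preserves_side X ->
  exists2 k, 0 < k &
    [exists c : {ffun {set G} -> 'I_k}, distinguishing_edges c].
Proof.
move=> G_conn bX sideX.
exists #|{: {set G}}|; first by apply/card_gt0P; exists set0.
apply/existsP; exists [ffun e => enum_rank e].
apply/distinguishing_edgesP => p p_aut kept; apply/permP => x; rewrite perm1.
have [y xy|isolated] := pickP (adj x).
  have := kept x y xy; rewrite !ffunE => /enum_rank_inj pxy.
  have := set21 (p x) (p y); rewrite pxy !inE => /orP[/eqP//|/eqP px].
  by have := sideX p p_aut x; rewrite px (bX _ _ xy); case: (x \in X).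
apply/eqP; apply: (connected_ind (P := pred1 x) (x := x)) => //=.
by move=> u v uv /eqP ux; have := isolated v; rewrite -ux uv.
Qed.

(** * Bounds for the distinguishing indices of orientations, and their sharpness *)

Lemma arc_dist_index_le (G : sgraph) (X : {set G}) d (a : rel G) :
    edges_cross X -> preserves_side X -> is_dist_index G d -> orientation a ->
  exists2 m, is_arc_dist_index a m & m <= d.
Proof.
move=> bX sideX [d_gt0 /existsP[c dc] _] a_or.
apply: least_pos_exists => //; apply/existsP.
exists [ffun u => c [set u.1; u.2]]; apply: (arcs_of_edges bX) dc => //.
move=> x y u v _ _ _ _ [<-]; case: ifP => _; rewrite !ffunE //=.
by rewrite (setUC [set y]) (setUC [set v]).
Qed.

Lemma arc_dist_index_ge (G : sgraph) (X : {set G}) d (a : rel G) m :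
    edges_cross X -> preserves_side X -> is_dist_index G d -> orientation a ->
  is_arc_dist_index a m -> uphalf d <= m.
Proof.
move=> bX sideX [_ _ d_min] a_or [m_gt0 /existsP[c dc] _].
rewrite leq_uphalf_double; case: m m_gt0 c dc => // m _ c dc.
(* The sign becomes the parity of the edge colour. *)
apply: d_min => //; pose g (s : bool * 'I_m.+1) : 'I_m.*2.+2 :=
  inord (s.1 + s.2.*2).
apply: (edges_of_arcs (g := g) bX sideX a_or) dc.
move=> x y u v _ _ _ _.
case: (signed_colour _ _ _ _) (signed_colour _ _ _ _) => [b i] [b' i'].
have g_val s : g s = s.1 + s.2.*2 :> nat.
  by rewrite inordK //; case: s => [[] [j /= j_lt]]; lia.
move/(congr1 val); rewrite /= !g_val /= => e.
have := congr1 odd e; have := congr1 half e.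
by rewrite !half_bit_double !oddD !odd_double !addbF !oddb => /val_inj-> ->.
Qed.

Lemma orientation_attaining_uphalf (G : sgraph) (X : {set G}) d :
    edges_cross X -> preserves_side X -> is_dist_index G d ->
  exists2 a : rel G, orientation a & is_arc_dist_index a (uphalf d).
Proof.
move=> bX sideX Gd; have [d_gt0 /existsP[c dc] _] := Gd.
(* Even colours point out of X, odd colours into X. *)
pose a x y := adj x y && ((x \in X) == ~~ odd (c [set x; y])).
have a_or : orientation a.
  move=> x y; rewrite /a [adj y x]adj_sym (setUC [set y]).
  case: (boolP (adj x y)) => //= xy; rewrite (bX _ _ xy).
  by case: (x \in X); case: (odd _).
exists a => //; have [m a_m _] := arc_dist_index_le bX sideX Gd a_or.
suff -> : uphalf d = m by [].
apply/eqP; rewrite eqn_leq (arc_dist_index_ge bX sideX Gd a_or a_m) /=.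
case: a_m => [_ _ m_min]; apply: m_min; first by case: (d) d_gt0.
have half_lt (e : {set G}) : (c e)./2 < uphalf d.
  by rewrite ltn_half_double; have := ltn_ord (c e); lia.
apply/existsP; exists [ffun u => Ordinal (half_lt [set u.1; u.2])].
apply: (arcs_of_edges bX) dc => // x y u v xX uX xy uv.
rewrite /signed_colour => -[same_dir].
have same_odd : odd (c [set x; y]) = odd (c [set u; v]).
  by move: same_dir; rewrite /a xX uX xy uv; do 2!case: (odd _).
rewrite -same_dir => same_colour; apply: val_inj.
rewrite -[LHS]odd_double_half -[RHS]odd_double_half same_odd; congr (_ + _.*2).
move: same_colour; case: ifP => _; rewrite !ffunE /= => -[] //.
by rewrite (setUC [set y]) (setUC [set v]).
Qed.

Lemma orientation_attaining_index (G : sgraph) (X : {set G}) d :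
    edges_cross X -> preserves_side X -> is_dist_index G d ->
  exists2 a : rel G, orientation a & is_arc_dist_index a d.
Proof.
move=> bX sideX Gd; have [_ _ d_min] := Gd.
pose a x y := adj x y && (x \in X).
have a_or : orientation a.
  move=> x y; rewrite /a [adj y x]adj_sym.
  case: (boolP (adj x y)) => //= xy; rewrite (bX _ _ xy).
  by case: (x \in X).
exists a => //; have [m a_m m_le] := arc_dist_index_le bX sideX Gd a_or.
suff -> : d = m by [].
apply/eqP; rewrite eqn_leq m_le andbT; case: a_m => [m_gt0 /existsP[c dc] _].
case: m m_gt0 c dc {m_le} => // m _ c dc; apply: d_min => //.
apply: (edges_of_arcs (g := snd) bX sideX a_or) dc => x y u v xX uX xy uv.
by rewrite /signed_colour /a xX uX xy uv /= => ->.
Qed.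

Theorem corollary4 (G : sgraph) (X Y : {set G})
  (G_connected : connected_graph G)
  (G_not_K2 : ~ isomorphic G (complete_graph 2))
  (XY_bipartition : bipartition X Y)
  (no_interchange :
     forall p : {perm G}, is_aut (@adj G) p -> ~ interchanges p X Y) :
  exists d : nat,
    [/\ is_dist_index G d, is_OD_min G (uphalf d) & is_OD_max G d].
Proof.
have bX := bipartition_cross XY_bipartition.
have sideX := aut_preserves_side G_connected XY_bipartition no_interchange.
have [k k_gt0 ck] := distinguishing_edges_exist G_connected bX sideX.
have [d Gd _] : exists2 d, is_dist_index G d & d <= k.
  exact: least_pos_exists.
exists d; split=> //; split.
- exact: orientation_attaining_uphalf bX sideX Gd.
- move=> a a_or; have [m a_m _] := arc_dist_index_le bX sideX Gd a_or.
  by exists m => //; apply: arc_dist_index_ge bX sideX Gd a_or a_m.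
- exact: orientation_attaining_index bX sideX Gd.
- by move=> a; apply: arc_dist_index_le bX sideX Gd.
Qed.
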